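(* Let $A\in\mathbb{H}^n_{++}$ and let $P\in\mathbb{H}^n_{++}$ be a preconditioner. For every integer $k\ge1$, the $k$-th residual of the preconditioned conjugate gradient method applied to $Ax=b$ with preconditioner $P$ (for any right-hand side $b$ and initial guess $x_0$) satisfies $$\|r_k\|_{P^{-1}} \le \Big(e^{\mathcal{D}_{\mathrm{LD}}(A,P)/k}-1\Big)^{k/2}\,\|r_0\|_{P^{-1}}.$$
   Context: $\mathbb{H}^n_{++}$ denotes the set of $n\times n$ Hermitian positive definite matrices. For $A,P\in\mathbb{H}^n_{++}$ the Bregman log determinant divergence is $$\mathcal{D}_{\mathrm{LD}}(A,P) = \operatorname{tr}(AP^{-1}) - \ln\det(AP^{-1}) - n.$$ For $H\in\mathbb{H}^n_{++}$, $\|v\|_H=(v^*Hv)^{1/2}$. Preconditioned conjugate gradient method (PCG) for $Ax=b$ with preconditioner $P$, $H=P^{-1}$, and initial guess $x_0$: $r_0=b-Ax_0$, $p_0=Hr_0$, and for $k=0,1,2,\dots$ $$\alpha_k=\frac{r_k^*Hr_k}{p_k^*Ap_k},\quad x_{k+1}=x_k+\alpha_kp_k,\quad r_{k+1}=r_k-\alpha_kAp_k,\quad \beta_k=\frac{r_{k+1}^*Hr_{k+1}}{r_k^*Hr_k},\quad p_{k+1}=Hr_{k+1}+\beta_kp_k.$$ If $r_k=0$ the iteration stops, and by convention $r_j=0$ and $x_j=x_k$ for all $j\ge k$. *)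

(* Defs.v *)
From mathcomp Require Import all_boot all_order all_algebra.
From mathcomp Require Import complex.
From mathcomp Require Import reals sequences exp.

Set Implicit Arguments.
Unset Strict Implicit.
Unset Printing Implicit Defensive.

Import Order.TTheory GRing.Theory Num.Theory.
Local Open Scope ring_scope.
Local Open Scope sesquilinear_scope.
Local Open Scope complex_scope.

Section Definitions.
Variables (R : realType) (n : nat).
Implicit Types (A P H : 'M[R[i]]_n) (u v b x : 'cV[R[i]]_n) (k : nat).

Definition inner H u v : R[i] := (u ^t* *m H *m v) 0 0.

(* The order on R[i] is partial: 0 < z means that z is real and positive. *)
Definition hermitian_posdef A : Prop :=
  A \is hermsymmx /\ forall v, v != 0 -> 0 < inner A v v.

(* The trace, determinant and quadratic form below have type R[i] but are real
   for Hermitian positive definite arguments, so complex.Re only changes the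
   type. *)
Definition logdet_div A P : R :=
  complex.Re (\tr (A *m invmx P)) - ln (complex.Re (\det (A *m invmx P)))
  - n%:R.

Definition norm_wrt H v : R := Num.sqrt (complex.Re (inner H v v)).

Record pcg_state := PCGState {
  iterate : 'cV[R[i]]_n;
  residual : 'cV[R[i]]_n;
  direction : 'cV[R[i]]_n }.

Definition pcg_init A P b x0 : pcg_state :=
  let r0 := b - A *m x0 in PCGState x0 r0 (invmx P *m r0).

Definition pcg_step A P (s : pcg_state) : pcg_state :=
  let: PCGState x r p := s in
  let H := invmx P in
  if r == 0 then s else
  let alpha := inner H r r / inner A p p in
  let x' := x + alpha *: p in
  let r' := r - alpha *: (A *m p) in
  let beta := inner H r' r' / inner H r r in
  PCGState x' r' (H *m r' + beta *: p).

Definition pcg A P b x0 k : pcg_state :=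
  iter k (pcg_step A P) (pcg_init A P b x0).

Definition pcg_residual A P b x0 k : 'cV[R[i]]_n :=
  residual (pcg A P b x0 k).

End Definitions.

(* Main.v *)
Require Import Defs.
From mathcomp Require Import all_boot all_order all_algebra.
From mathcomp Require Import complex.
From mathcomp Require Import reals sequences exp.
From mathcomp Require Import ring lra.

(** Write [z_j = P^-1 r_j], [rho_j = |r_j|^2] in the norm of [P^-1],
    [pi_j = p_j^* A p_j], [d_j = pi_j / rho_j = 1 / alpha_j] and
    [beta_j = rho_{j+1} / rho_j].  If [r_k = 0] there is nothing to prove, so
    let [r_0, ..., r_k] be nonzero.

    The vectors [z_0, ..., z_k] are orthogonal for [P], and normalised they
    turn [A] into the Lanczos matrix, which is tridiagonal with diagonal
    [d_0, d_1 + beta_0 d_0, d_2 + beta_1 d_1, ...] and off-diagonal entries of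
    squared modulus [beta_j d_j^2] ([cg_orthogonal], [cg_sum_ln_le]).  Complete
    them to a [P]-orthonormal basis, the columns of [V]
    ([orthonormal_complete]).  Then [T = V^* A V] has the trace and the
    determinant of [A P^-1], so the divergence is
    [gap T = tr T - ln det T - n] ([logdet_gap_basis]).

    This gap is bounded from below by eliminating one row at a time.  If [a]
    is the corner entry of [T], [w] the rest of its first column and [S] the
    Schur complement of [a], then
      [gap T = (a + |w|^2 / a - ln a - 1) + gap S].
    For the Lanczos matrix [a = d_0] and [|w|^2 >= beta_0 a^2], so
    [ln x <= x - 1] at [x = a (1 + beta_0)] bounds the bracket below by
    [ln (1 + beta_0)]; moreover [S] is the Lanczos matrix with its indices
    shifted by one, because the correction removes exactly the term
    [beta_0 d_0] from the entry [d_1 + beta_0 d_0].  By induction the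
    divergence is at least the sum of [ln (1 + beta_j)] over [j < k]
    ([logdet_gap_tridiagonal]).

    Finally [t |-> ln (1 + e^t)] is convex, so that sum is at least
    [k ln (1 + g)] where [g = (rho_k / rho_0)^(1/k)] is the geometric mean of
    the [beta_j] ([sum_ln1p_ge]).  Hence [g <= e^(D/k) - 1], and raising to the
    power [k/2] gives the bound. *)

Import Order.TTheory GRing.Theory Num.Theory.
Local Open Scope ring_scope.

(** * Sesquilinear forms of Hermitian matrices *)

Section Forms.
Local Open Scope sesquilinear_scope.
Context {R : realType}.
Local Notation C := R[i].

Lemma ctrmx_mul {m n p} (X : 'M[C]_(m, n)) (Y : 'M[C]_(n, p)) :
  (X *m Y)^t* = Y^t* *m X^t*.
Proof. by rewrite trmx_mul map_mxM. Qed.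

Lemma hermsymmxP {n} (H : 'M[C]_n) : reflect (H^t* = H) (H \is hermsymmx).
Proof.
by apply: (iffP (is_hermitianmxP _ _ _)); rewrite expr0 scale1r => /esym.
Qed.

Context {n : nat}.
Implicit Types (H V : 'M[C]_n) (u v w : 'cV[C]_n).

Lemma innerDr H u v w : inner H u (v + w) = inner H u v + inner H u w.
Proof. by rewrite /inner mulmxDr mxE. Qed.

Lemma innerZr H u v a : inner H u (a *: v) = a * inner H u v.
Proof. by rewrite /inner -scalemxAr mxE. Qed.

Lemma innerDl H u v w : inner H (u + v) w = inner H u w + inner H v w.
Proof. by rewrite /inner linearD map_mxD !mulmxDl mxE. Qed.

Lemma innerZl H u v a : inner H (a *: u) v = a^* * inner H u v.
Proof. by rewrite /inner linearZ map_mxZ -!scalemxAl mxE. Qed.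

Lemma inner_conj H u v : H \is hermsymmx -> (inner H u v)^* = inner H v u.
Proof.
move=> /hermsymmxP hH; rewrite /inner.
have -> : v^t* *m H *m u = (u^t* *m H *m v)^t*.
  by rewrite !ctrmx_mul trmxCK hH mulmxA.
by rewrite [in RHS]mxE [in RHS]mxE.
Qed.

Lemma inner_mulmxr H V u v : inner H u (V *m v) = inner (H *m V) u v.
Proof. by rewrite /inner !mulmxA. Qed.

Lemma inner_congr {m} H (X : 'M[C]_(n, m)) (u v : 'cV[C]_m) :
  inner (X^t* *m H *m X) u v = inner H (X *m u) (X *m v).
Proof. by rewrite /inner ctrmx_mul !mulmxA. Qed.

Lemma hermsymmx_congr {m} H (X : 'M[C]_(n, m)) :
  H \is hermsymmx -> X^t* *m H *m X \is hermsymmx.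
Proof.
move=> /hermsymmxP hH; apply/hermsymmxP.
by rewrite !ctrmx_mul trmxCK hH mulmxA.
Qed.

Lemma posdef_congr {H V} : hermitian_posdef H -> V \in unitmx ->
  hermitian_posdef (V^t* *m H *m V).
Proof.
move=> [hH pH] uV; split=> [|v v0]; first exact: hermsymmx_congr.
rewrite inner_congr pH //; apply: contraNneq v0 => Vv0.
by rewrite -(mulKmx uV v) Vv0 mulmx0.
Qed.

End Forms.

(** * A convexity inequality for the logarithm *)

Section Jensen.
Context {R : realType}.
Implicit Types x g b : R.

Lemma ln_le_subr1 {x} : 0 < x -> ln x <= x - 1.
Proof.
move=> x0; rewrite -[x in ln x](subrKC 1) le_ln1Dx //.
by rewrite -subr_gt0 opprK subrK.
Qed.

(** The tangent at [t = ln g] of the convex function [t |-> ln (1 + e^t)],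
    evaluated at [t = ln b]. *)
Lemma ln1p_tangent {g b} : 0 < g -> 0 < b ->
  ln (1 + g) + g / (1 + g) * (ln b - ln g) <= ln (1 + b).
Proof.
move=> g0 b0.
have g1 : 0 < 1 + g by rewrite addr_gt0.
have b1 : 0 < 1 + b by rewrite addr_gt0.
have h1 := ln_le_subr1 (divr_gt0 g1 b1).
have h2 := ln_le_subr1 (divr_gt0 (mulr_gt0 b0 g1) (mulr_gt0 g0 b1)).
move: h1 h2; rewrite !ln_div ?lnM ?posrE ?mulr_gt0 // => h1 h2.
have w0 : 0 <= g / (1 + g) by rewrite divr_ge0 ?ltW.
have w1 : 0 <= 1 / (1 + g) by rewrite divr_ge0 ?ltW.
(* The two instances of ln x <= x - 1 are averaged with the weights
   1 / (1 + g) and g / (1 + g), for which the right-hand sides cancel. *)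
have := lerD (ler_wpM2l w1 h1) (ler_wpM2l w0 h2).
rewrite -subr_ge0 => h; rewrite -subr_ge0; move: h.
congr (0 <= _); field.
by rewrite !gt_eqF.
Qed.

(** Jensen's inequality for [t |-> ln (1 + e^t)]: the tangent lines are taken
    at the mean [ln g] of the [ln (b j)], so their linear parts sum to zero. *)
Lemma sum_ln1p_ge {k : nat} {b : nat -> R} : (0 < k)%N ->
  (forall j, (j < k)%N -> 0 < b j) ->
  k%:R * ln (1 + expR ((\sum_(j < k) ln (b j)) / k%:R))
  <= \sum_(j < k) ln (1 + b j).
Proof.
move=> k0 b0; set g := expR _.
have g0 : 0 < g by apply: expR_gt0.
have kn0 : k%:R != 0 :> R by rewrite pnatr_eq0 -lt0n.
have h : \sum_(j < k) (ln (1 + g) + g / (1 + g) * (ln (b j) - ln g))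
         <= \sum_(j < k) ln (1 + b j).
  by apply: ler_sum => j _; apply: ln1p_tangent => //; apply: b0.
apply: le_trans h.
rewrite big_split /= -mulr_sumr sumrB !sumr_const card_ord.
rewrite {4}/g expRK -[X in _ - X]mulr_natr divfK // subrr mulr0 addr0.
by rewrite mulr_natl.
Qed.
End Jensen.

(** * Schur complements of positive definite matrices *)

Section Schur.
Local Open Scope sesquilinear_scope.
Context {R : realType}.
Local Notation C := R[i].

Definition schur {n} (T : 'M[C]_(1 + n)) : 'M[C]_n :=
  drsubmx T - (T 0 0)^-1 *: (dlsubmx T *m ursubmx T).

Lemma posdef_diag_gt0 {n} {T : 'M[C]_n} (i : 'I_n) :
  hermitian_posdef T -> 0 < T i i.
Proof.
move=> [_ pT].
have := pT (delta_mx i 0); rewrite /inner trmx_delta map_delta_mx.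
rewrite -rowE -colE !mxE; apply.
by apply/eqP => /matrixP /(_ i 0); rewrite !mxE !eqxx => /eqP; rewrite oner_eq0.
Qed.

(** Clearing the first row and column by a unipotent [E] is one step of
    Gaussian elimination; positivity, the determinant and the Hermitian symmetry
    of the Schur complement are all read off from this congruence. *)
Lemma schur_congr {n} {T : 'M[C]_(1 + n)} : hermitian_posdef T ->
  let E := block_mx 1%:M (- (T 0 0)^-1 *: ursubmx T) 0 1%:M in
  E^t* *m T *m E = block_mx (T 0 0)%:M 0 0 (schur T).
Proof.
move=> hT E; have a0 := posdef_diag_gt0 0 hT.
have [/hermsymmxP hh _] := hT.
have hul : ulsubmx T = (T 0 0)%:M.
  by rewrite [LHS]mx11_scalar !mxE lshift0.
have hur : (ursubmx T)^t* = dlsubmx T.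
  by rewrite trmx_ursub map_dlsubmx hh.
have ac : ((T 0 0)^-1)^* = (T 0 0)^-1 by rewrite geC0_conj // invr_ge0 ltW.
rewrite -[T in _ *m T *m _]submxK /E tr_block_mx map_block_mx.
rewrite !trmx1 !map_mx1 !trmx0 !map_mx0 !linearZ /= map_mxZ hur rmorphN /= ac.
rewrite !mulmx_block !mul1mx !mul0mx !mulmx1 !mulmx0 !addr0 !hul.
rewrite -!scalemxAl -!scalemxAr !mul_scalar_mx !mul_mx_scalar !scalerA.
rewrite !mulNr !mulVf ?gt_eqF // !scaleN1r !addNr.
by rewrite /schur mul0mx scaler0 add0r addrC scaleNr.
Qed.

Lemma posdef_schur {n} {T : 'M[C]_(1 + n)} :
  hermitian_posdef T -> hermitian_posdef (schur T).
Proof.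
move=> hT; have := schur_congr hT; set E := block_mx _ _ _ _ => /= hE.
have uE : E \in unitmx by rewrite unitmxE det_ublock !det1 mulr1 unitr1.
have := posdef_congr hT uE; rewrite hE => -[/hermsymmxP hB pB].
split=> [|v v0].
  apply/hermsymmxP; move: hB; rewrite tr_block_mx map_block_mx.
  by case/eq_block_mx.
have := pB (col_mx 0 v); rewrite /inner tr_col_mx map_row_mx mul_row_block.
rewrite mul_row_col !trmx0 !map_mx0 !mul0mx !mulmx0 !add0r; apply.
by rewrite col_mx_eq0 negb_and v0 orbT.
Qed.

Lemma det_schur {n} {T : 'M[C]_(1 + n)} : hermitian_posdef T ->
  \det T = T 0 0 * \det (schur T).
Proof.
move=> hT; have := schur_congr hT; set E := block_mx _ _ _ _ => /= hE.
have dE : \det E = 1 by rewrite det_ublock !det1 mulr1.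
move/(congr1 determinant): hE.
rewrite det_ublock det_scalar expr1 => <-.
by rewrite !det_mulmx det_map_mx det_tr dE rmorph1 mul1r mulr1.
Qed.

Lemma mxtrace_schur {n} (T : 'M[C]_(1 + n)) :
  \tr T = T 0 0 + (T 0 0)^-1 * (\sum_(i < n) T 0 (lift 0 i) * T (lift 0 i) 0)
          + \tr (schur T).
Proof.
rewrite /schur linearB linearZ /= mxtrace_mulC.
rewrite [\tr (ursubmx T *m _)]big_ord1 mxE.
rewrite -{1}[T]submxK mxtrace_block [\tr (ulsubmx T)]big_ord1 !mxE !lshift0.
under [in RHS]eq_bigr do rewrite -!rshift1.
under [X in _ = _ + (_ - _ * X)]eq_bigr do rewrite !mxE !lshift0.
by rewrite addrACA subrr addr0.
Qed.

Lemma posdef_det_gt0 {n} {T : 'M[C]_n} : hermitian_posdef T -> 0 < \det T.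
Proof.
elim: n T => [|n IHn] T hT; first by rewrite det_mx00.
rewrite (det_schur hT) mulr_gt0 ?posdef_diag_gt0 //.
exact/IHn/posdef_schur.
Qed.

Lemma schurE {n} (T : 'M[C]_(1 + n)) i j :
  schur T i j = T (lift 0 i) (lift 0 j)
                - (T 0 0)^-1 * (T (lift 0 i) 0 * T 0 (lift 0 j)).
Proof. by rewrite !mxE big_ord1 !mxE !lshift0 !rshift1. Qed.

End Schur.

(** * The gap between the trace and the logarithm of the determinant *)

Section LogdetGap.
Context {R : realType}.
Local Notation C := R[i].
Local Notation Re := complex.Re.

Lemma ReD (x y : C) : Re (x + y) = Re x + Re y.
Proof. by case: x y => [? ?] []. Qed.

Lemma Re_gt0 {x : C} : 0 < x -> 0 < Re x.
Proof. by rewrite ltcE => /andP[]. Qed.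

Lemma Re_ge0 {x : C} : 0 <= x -> 0 <= Re x.
Proof. by rewrite lecE => /andP[]. Qed.

Lemma ReK {x : C} : 0 <= x -> (Re x)%:C%C = x.
Proof. by move=> x0; rewrite RRe_real // ger0_real. Qed.

Lemma ReM_ge0 {x y : C} : 0 <= x -> Re (x * y) = Re x * Re y.
Proof. by move=> /ReK <-; case: y => a b /=; rewrite mul0r subr0. Qed.

(** For [T] positive definite this is the divergence of [T] from the identity
    matrix. *)
Definition logdet_gap {n} (T : 'M[C]_n) : R :=
  Re (\tr T) - ln (Re (\det T)) - n%:R.

Lemma logdet_gap_schur {n} {T : 'M[C]_(1 + n)} : hermitian_posdef T ->
  logdet_gap T =
    (Re (T 0 0) + Re ((T 0 0)^-1 *
       (\sum_(i < n) T 0 (lift 0 i) * T (lift 0 i) 0)) - ln (Re (T 0 0)) - 1)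
    + logdet_gap (schur T).
Proof.
move=> hT; have a0 := posdef_diag_gt0 0 hT.
have d0 := posdef_det_gt0 (posdef_schur hT).
rewrite /logdet_gap mxtrace_schur (det_schur hT) ReM_ge0 ?ltW //.
rewrite lnM ?posrE ?Re_gt0 // !ReD -natr1; ring.
Qed.

Lemma posdef_entry_sqr_ge0 {n} {T : 'M[C]_n} (i j : 'I_n) :
  hermitian_posdef T -> 0 <= T i j * T j i.
Proof.
move=> [/hermsymmxP hT _]; rewrite -[in T j i]hT !mxE.
exact: mul_conjC_ge0.
Qed.

(** With [a = T 0 0] and [w] the rest of the first row, the hypothesis says
    [e a^2 <= |w|^2], so the eliminated row contributes at least
    [a (1 + e) - ln a - 1], which is at least [ln (1 + e)] by [ln x <= x - 1]
    at [x = a (1 + e)]. *)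
Lemma logdet_gap_schur_ge {n} {T : 'M[C]_(1 + n)} (e : R) :
  hermitian_posdef T -> 0 <= e ->
  e%:C%C * T 0 0 ^+ 2 <= \sum_(i < n) T 0 (lift 0 i) * T (lift 0 i) 0 ->
  ln (1 + e) + logdet_gap (schur T) <= logdet_gap T.
Proof.
move=> hT e0 he; rewrite (logdet_gap_schur hT) lerD2r.
have a0 := posdef_diag_gt0 0 hT; have ra0 := Re_gt0 a0.
have h : Re (T 0 0) * e <= Re ((T 0 0)^-1 *
       (\sum_(i < n) T 0 (lift 0 i) * T (lift 0 i) 0)).
  have : (Re (T 0 0) * e)%:C%C <= (T 0 0)^-1 *
       (\sum_(i < n) T 0 (lift 0 i) * T (lift 0 i) 0).
    rewrite [(T 0 0)^-1 * _]mulrC ler_pdivlMr // rmorphM /= (ReK (ltW a0)).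
    by rewrite mulrAC -expr2 mulrC.
  by rewrite lecE => /andP[].
have e1 : 0 < 1 + e by rewrite ltr_wpDr.
have := ln_le_subr1 (mulr_gt0 ra0 e1).
rewrite lnM ?posrE //; move: h; lra.
Qed.

Lemma logdet_gap_ge0 {n} {T : 'M[C]_n} : hermitian_posdef T ->
  0 <= logdet_gap T.
Proof.
elim: n T => [|n IHn] T hT.
  by rewrite /logdet_gap /mxtrace big_ord0 det_mx00 ln1 !subr0.
apply: le_trans (logdet_gap_schur_ge 0 hT _ _) => //.
  by rewrite addr0 ln1 add0r IHn //; exact: posdef_schur.
by rewrite mul0r sumr_ge0 // => i _; exact: posdef_entry_sqr_ge0.
Qed.

(** Only the leading block of order [k + 1] is constrained: it has the shape
    [L D L^*] with [D] the diagonal of the [d j] and [L] unit lower bidiagonal,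
    its subdiagonal having squared moduli [e j].  Eliminating the first row
    leaves a matrix of the same kind for the shifted sequences. *)
Lemma logdet_gap_tridiagonal {n} {T : 'M[C]_n} {k} {d e : nat -> R} :
  hermitian_posdef T -> (k < n)%N ->
  (forall i, (i < k)%N -> 0 <= e i) ->
  (forall i : 'I_n, i = 0%N :> nat -> T i i = (d 0%N)%:C%C) ->
  (forall i j : 'I_n, j = i.+1 :> nat -> (j <= k)%N ->
     T j j = (d j + e i * d i)%:C%C /\
     T i j * T j i = (e i * d i ^+ 2)%:C%C) ->
  (forall i j : 'I_n, (i.+1 < j)%N -> (j <= k)%N -> T i j = 0) ->
  \sum_(j < k) ln (1 + e j) <= logdet_gap T.
Proof.
elim: k n T d e => [|k IHk] [|n] // T d e hT kn e0 T00 Tsub Tfar.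
  by rewrite big_ord0 logdet_gap_ge0.
have d0 : T 0 0 = (d 0%N)%:C%C by apply: T00.
have d0_neq0 : T 0 0 != 0 by rewrite gt_eqF // posdef_diag_gt0.
rewrite big_ord_recl.
apply: le_trans (logdet_gap_schur_ge (e 0%N) hT _ _).
- rewrite lerD2l.
  have := IHk n (schur T) (fun j => d j.+1) (fun j => e j.+1).
  apply=> //; first exact: posdef_schur.
  + by move=> i ik; apply: e0.
  + move=> i i0; rewrite schurE.
    (* The corner of the Schur complement is (d 1 + e 0 * d 0) minus
       (e 0 * d 0 ^ 2) / d 0. *)
    have [||-> h] := Tsub 0 (lift 0 i); rewrite ?lift0 ?i0 //=.
    rewrite [X in _ - _ * X]mulrC h !rmorphD !rmorphM /= -d0.
    by field.
  + move=> i j ij jk; have i1j : (1 < lift 0%R j)%N by rewrite lift0 ij.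
    have T0j : T 0 (lift 0 j) = 0 by apply: Tfar => //; rewrite lift0.
    have Tj0 : T (lift 0 j) 0 = 0.
      by have [/hermsymmxP <- _] := hT; rewrite !mxE T0j rmorph0.
    rewrite !schurE T0j Tj0 !(mulr0, mul0r) !subr0.
    have [||-> ->] := Tsub (lift 0 i) (lift 0 j); rewrite ?lift0 ?ltnS ?ij //.
    by rewrite -ij.
  + move=> i j ij jk; rewrite schurE.
    have -> : T 0 (lift 0 j) = 0.
      by apply: Tfar => //; rewrite lift0 // ltnS (leq_ltn_trans _ ij).
    by rewrite !mulr0 subr0 Tfar // !lift0.
- exact: e0.
(* The entry next to the corner alone provides e 0 * d 0 ^ 2. *)
- case: n kn T hT T00 Tsub Tfar d0 d0_neq0 => // n _ T hT _ Tsub _ d0 _.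
  rewrite big_ord_recl /=.
  have [||_ ->] := Tsub 0 (lift 0 0) => //.
  rewrite d0 rmorphM rmorphXn lerDl sumr_ge0 // => i _.
  exact: posdef_entry_sqr_ge0.
Qed.

End LogdetGap.

(** * Bases orthonormal for the preconditioner *)

Section OrthonormalBasis.
Local Open Scope sesquilinear_scope.
Context {R : realType} {n : nat}.
Local Notation C := R[i].
Implicit Types (A P : 'M[C]_n) (s : nat -> 'cV[C]_n).

Definition orthonormal P m s :=
  forall i j, (i < m)%N -> (j < m)%N -> inner P (s i) (s j) = (i == j)%:R.

Definition col_family m s : 'M[C]_(n, m) := \matrix_(i, j) s j i 0.

Lemma col_col_family m s (j : 'I_m) : col j (col_family m s) = s j.
Proof. by apply/matrixP => a b; rewrite !mxE ord1. Qed.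

Lemma gram_entry A m s (i j : 'I_m) :
  ((col_family m s)^t* *m A *m col_family m s) i j = inner A (s i) (s j).
Proof.
rewrite -!col_col_family /inner; set V := col_family m s.
have -> : (col i V)^t* *m A *m col j V = row i (col j (V^t* *m A *m V)).
  rewrite [col i V]colE ctrmx_mul trmx_delta map_delta_mx rowE !colE.
  by rewrite !mulmxA.
by rewrite [in RHS]mxE [in RHS]mxE.
Qed.

Lemma orthonormalP P m s : orthonormal P m s <->
  (col_family m s)^t* *m P *m col_family m s = 1%:M.
Proof.
split=> [os|/matrixP h i j im jm].
  by apply/matrixP => i j; rewrite gram_entry os // mxE.
by have := h (Ordinal im) (Ordinal jm); rewrite gram_entry mxE.
Qed.

(** The Gram matrix of the family is the identity of order [m], and it factors
    through dimension [n]. *)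
Lemma orthonormal_leq {P m s} : orthonormal P m s -> (m <= n)%N.
Proof. by move=> /orthonormalP; exact: mulmx1_min. Qed.

(** The [m] linear conditions of orthogonality to the family have a nonzero
    solution as [m < n]; it is a column of the cokernel of the matrix of these
    conditions. *)
Lemma orthonormal_add1 {P m s} : hermitian_posdef P -> (m < n)%N ->
  orthonormal P m s ->
  exists v, orthonormal P m.+1 (fun i => if i == m then v else s i).
Proof.
move=> [hP pP] mn os; set B := (col_family m s)^t* *m P.
have : cokermx B != 0.
  rewrite -mxrank_eq0 mxrank_coker subn_eq0 -ltnNge.
  by rewrite (leq_ltn_trans (rank_leq_row _)).
move=> /eqP/matrixP K; have [j vj] : exists j, col j (cokermx B) != 0.
  apply/existsP; apply: contra_notT K; rewrite negb_exists => /forallP h i j.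
  by have /negPn/eqP/matrixP/(_ i 0) := h j; rewrite !mxE.
set v := col j _ in vj.
have sv i : (i < m)%N -> inner P (s i) v = 0.
  move=> im; rewrite -[s i]/(s (Ordinal im)) -col_col_family /inner /v.
  rewrite colE ctrmx_mul trmx_delta map_delta_mx -rowE -row_mul -/B.
  by rewrite colE mulmxA -row_mul mulmx_coker row0 mul0mx mxE.
pose c := (sqrtC (inner P v v))^-1; have v0 := pP _ vj.
have c0 : 0 <= c by rewrite invr_ge0 sqrtC_ge0 ltW.
exists (c *: v) => i k; rewrite !ltnS.
case: eqP => [->|/eqP im]; case: eqP => [->|/eqP km].
- move=> _ _; rewrite innerZr innerZl eqxx geC0_conj // mulrA -expr2 exprVn.
  by rewrite sqrtCK mulVf // gt_eqF.
- move=> _; rewrite leq_eqVlt (negPf km) => /= km'.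
  by rewrite innerZl -inner_conj // sv // rmorph0 mulr0 eq_sym (negPf km).
- rewrite leq_eqVlt (negPf im) => /= im' _.
  by rewrite innerZr sv // mulr0.
rewrite leq_eqVlt (negPf im) => /= im'; rewrite leq_eqVlt (negPf km) => /= km'.
exact: os.
Qed.

Lemma orthonormal_complete {P m s} : hermitian_posdef P ->
  orthonormal P m s ->
  exists2 s', orthonormal P n s' & forall i, (i < m)%N -> s' i = s i.
Proof.
move=> hP os; have [l] : {l | (n - m)%N = l} by exists (n - m)%N.
elim: l m s os => [|l IHl] m s os nml.
  exists s => //; suff <- : m = n by [].
  by apply/eqP; rewrite eqn_leq (orthonormal_leq os) -subn_eq0 nml /=.
have mn : (m < n)%N by rewrite -subn_gt0 nml.
have [v os1] := orthonormal_add1 hP mn os.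
have [|s' os' s's] := IHl _ _ os1; first by rewrite subnS nml.
exists s' => // i im; rewrite s's ?ltn_eqF //.
exact: ltnW.
Qed.

(** The hypothesis says that [V V^*] is the inverse of [P]; the trace and the
    determinant are invariant under cyclic permutation of the factors. *)
Lemma logdet_gap_basis {A P : 'M[C]_n} {V : 'M[C]_n} :
  V^t* *m P *m V = 1%:M ->
  logdet_gap (V^t* *m A *m V) = logdet_div A P.
Proof.
move=> hV.
have hVP : V *m V^t* *m P = 1%:M by rewrite -mulmxA; exact: mulmx1C.
have [_ uP] := mulmx1_unit hVP.
have -> : V^t* *m A *m V = V^t* *m (A *m V) by rewrite mulmxA.
rewrite /logdet_gap mxtrace_mulC det_mulmx mulrC -det_mulmx -mulmxA.
by rewrite -[V *m V^t*](mulmxK uP) hVP mul1mx.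
Qed.

(** The hypotheses on the [z j] say that, after normalisation in the norm of
    [P], they represent [A] by the Lanczos matrix with pivots [d j]. *)
Lemma logdet_div_tridiagonal {A P : 'M[C]_n} {k} {z : nat -> 'cV[C]_n}
    {rho d : nat -> R} :
  hermitian_posdef A -> hermitian_posdef P ->
  (forall j, (j <= k)%N -> inner P (z j) (z j) = (rho j)%:C%C) ->
  (forall j, (j <= k)%N -> 0 < rho j) ->
  (forall i j, (i < j)%N -> (j <= k)%N -> inner P (z i) (z j) = 0) ->
  inner A (z 0%N) (z 0%N) = (d 0%N * rho 0%N)%:C%C ->
  (forall j, (j < k)%N ->
     inner A (z j.+1) (z j.+1)
       = ((d j.+1 + rho j.+1 / rho j * d j) * rho j.+1)%:C%C /\
     inner A (z j) (z j.+1) = (- (d j * rho j.+1))%:C%C) ->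
  (forall i j, (i.+1 < j)%N -> (j <= k)%N -> inner A (z i) (z j) = 0) ->
  \sum_(j < k) ln (1 + rho j.+1 / rho j) <= logdet_div A P.
Proof.
move=> hA hP rhoE rho0 zP z00 zsub zfar.
pose c j : C := ((Num.sqrt (rho j))^-1)%:C%C.
have realJ (x : R) : (x%:C%C)^* = x%:C%C.
  by rewrite conj_Creal //; apply/complex_realP; exists x.
have c2 j : (j <= k)%N -> c j * c j = ((rho j)^-1)%:C%C.
  by move=> jk; rewrite -rmorphM /= -expr2 exprVn sqr_sqrtr ?ltW ?rho0.
pose s j := c j *: z j.
have sE H i j : inner H (s i) (s j) = c i * c j * inner H (z i) (z j).
  by rewrite innerZl innerZr realJ mulrA.
have os : orthonormal P k.+1 s.
  move=> i j; rewrite !ltnS sE; case: (ltngtP i j) => [ij|ij|<-] ik jk.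
  - by rewrite zP // mulr0.
  - by rewrite -inner_conj ?hP.1 // zP // rmorph0 mulr0.
  - by rewrite c2 // rhoE // -rmorphM /= mulVf ?gt_eqF ?rho0.
have [s' /orthonormalP os' s's] := orthonormal_complete hP os.
rewrite -(logdet_gap_basis os').
have [_ uV] := mulmx1_unit os'.
apply: (logdet_gap_tridiagonal (d := d) (e := fun j => rho j.+1 / rho j)).
- exact: posdef_congr.
- exact: orthonormal_leq os.
- by move=> i ik; rewrite divr_ge0 // ltW // rho0 // ltnW.
- move=> i i0; rewrite gram_entry i0 s's // sE c2 // z00 -rmorphM /=.
  by rewrite mulrC mulfK // gt_eqF ?rho0.
- move=> i j ij jk; have ik : (i < k)%N by rewrite -ij.
  have ri : rho i != 0 by rewrite gt_eqF ?rho0 // ltnW.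
  have rj : rho j != 0 by rewrite gt_eqF ?rho0.
  rewrite !gram_entry !s's // ?ltnS 1?ltnW // !sE.
  rewrite -[inner A (z j) (z i)]inner_conj ?hA.1 //.
  have [hd ho] := zsub i ik; rewrite -ij in hd ho *; rewrite hd ho.
  split.
    by rewrite c2 // -rmorphM /= mulrC mulfK.
  rewrite realJ.
  transitivity ((c i * c i) * (c j * c j) * ((d i * rho j)%:C%C ^+ 2)).
    by rewrite rmorphN; ring.
  rewrite !c2 ?(ltnW ik) // -rmorphXn -!rmorphM /=; congr (_%:C)%C; field.
  by rewrite ri.
- move=> i j ij jk.
  rewrite gram_entry !s's // ?sE ?zfar ?mulr0 // ltnS.
  by rewrite (leq_trans (ltnW (ltnW ij))).
Qed.

End OrthonormalBasis.

(** * Orthogonality in the conjugate gradient recurrence *)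

Section ConjugateGradient.
Context {R : realType} {n : nat}.
Local Notation C := R[i].
Variables (A P : 'M[C]_n).
Hypotheses (hA : hermitian_posdef A) (hP : hermitian_posdef P).
Variables (z p : nat -> 'cV[C]_n) (k : nat).
Let rho j := inner P (z j) (z j).
Let pi j := inner A (p j) (p j).
Hypothesis z_neq0 : forall j, (j <= k)%N -> z j != 0.
Hypothesis p0E : p 0%N = z 0%N.
Hypothesis zS : forall j, (j < k)%N ->
  z j.+1 = z j - (rho j / pi j) *: (invmx P *m (A *m p j)).
Hypothesis pS : forall j, (j < k)%N ->
  p j.+1 = z j.+1 + (rho j.+1 / rho j) *: p j.

Let rho_gt0 {j} : (j <= k)%N -> 0 < rho j.
Proof. by move=> jk; apply: hP.2; exact: z_neq0. Qed.

Let inner_P_invmx u v : inner P u (invmx P *m (A *m v)) = inner A u v.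
Proof.
rewrite inner_mulmxr mulmxV ?unitmxE ?unitfE ?gt_eqF ?posdef_det_gt0 //.
by rewrite inner_mulmxr mul1mx.
Qed.

Let beta_conj j : (j < k)%N -> (rho j.+1 / rho j)^* = rho j.+1 / rho j.
Proof.
by move=> jk; rewrite geC0_conj // divr_ge0 // ltW // rho_gt0 // ltnW.
Qed.

(** Each direction [p m] is a combination of [z 0, ..., z m]. *)
Lemma inner_direction_eq0 v m : (m <= k)%N ->
  (forall i, (i <= m)%N -> inner P (z i) v = 0) -> inner P (p m) v = 0.
Proof.
elim: m => [|m IHm] mk zv; first by rewrite p0E zv.
rewrite pS // innerDl innerZl zv // IHm ?mulr0 ?addr0 // 1?ltnW //.
by move=> i im; rewrite zv // leqW.
Qed.

(** Three invariants proved together: the preconditioned residuals are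
    [P]-orthogonal, the directions are [A]-conjugate, and the directions are
    nonzero.  The last one holds because [p j] and [z j] have the inner product
    [rho j], and it makes the next step length meaningful. *)
Lemma cg_orthogonal m : (m <= k)%N ->
  [/\ forall i j, (i < j)%N -> (j <= m)%N -> inner P (z i) (z j) = 0,
      forall i j, (i < j)%N -> (j <= m)%N -> inner A (p i) (p j) = 0
    & forall j, (j <= m)%N -> 0 < pi j].
Proof.
have pi_gt0 j : (j <= k)%N -> inner P (p j) (z j) = rho j -> 0 < pi j.
  move=> jk pz; apply: hA.2; apply/eqP => pj0.
  move: (rho_gt0 jk); rewrite -pz pj0 /inner trmx0 map_mx0 !mul0mx mxE.
  by rewrite ltxx.
elim: m => [|m IHm] mk.
  split=> [i [] //|i [] //|j]; rewrite leqn0 => /eqP ->.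
  by apply: pi_gt0; rewrite ?p0E.
have [zz pp pi0] := IHm (ltnW mk).
have zp i : (i <= m)%N -> inner A (z i) (p m) = if i == m then pi m else 0.
  move=> im; have ppim : inner A (p i) (p m) = if i == m then pi m else 0.
    by case: eqP => [->//|/eqP im']; rewrite pp // ltn_neqAle im' im.
  case: i im ppim => [|i] im ppim; first by rewrite -p0E.
  have -> : z i.+1 = p i.+1 + (- (rho i.+1 / rho i)) *: p i.
    by rewrite pS ?scaleNr ?addrK // (leq_trans im) // ltnW.
  by rewrite innerDl innerZl (pp i) // mulr0 addr0.
have zzS i : (i <= m)%N -> inner P (z i) (z m.+1) = 0.
  move=> im; rewrite zS // -scaleNr innerDr innerZr inner_P_invmx zp //.
  case: eqP => [->|/eqP im']; last by rewrite mulr0 addr0 zz // ltn_neqAle im'.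
  by rewrite mulNr divfK ?gt_eqF ?pi0 // subrr.
have pz : inner P (p m.+1) (z m.+1) = rho m.+1.
  rewrite pS // innerDl innerZl (@inner_direction_eq0 _ m) ?mulr0 ?addr0 //.
  exact: ltnW.
have ppS i : (i <= m)%N -> inner A (p i) (p m.+1) = 0.
  move=> im; have ik : (i < k)%N by apply: leq_ltn_trans mk.
  have ri : rho i != 0 by rewrite gt_eqF // rho_gt0 // ltnW.
  have pi_i : pi i != 0 by rewrite gt_eqF // pi0.
  rewrite -inner_conj ?hA.1 // pS // innerDl innerZl beta_conj //.
  have -> : inner A (z m.+1) (p i)
            = - (if i == m then rho m.+1 / rho i * pi i else 0).
    rewrite -inner_P_invmx.
    (* The recurrence for z is solved for P^-1 A p i, which reduces
       conjugacy of the new direction to orthogonality of the z's. *)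
    have -> : invmx P *m (A *m p i) = (pi i / rho i) *: (z i - z i.+1).
      rewrite [z i.+1]zS // opprB addrC subrK scalerA.
      by rewrite mulrA divfK // mulfV // scale1r.
    rewrite innerZr innerDr -scaleN1r innerZr.
    rewrite -[inner P _ (z i)]inner_conj ?hP.1 // zzS // rmorph0 add0r.
    case: eqP => [->|/eqP im']; first by rewrite -/(rho _); ring.
    rewrite -[inner P _ (z i.+1)]inner_conj ?hP.1 // zzS
            ?rmorph0 ?mulr0 ?oppr0 //.
    by rewrite ltn_neqAle im' im.
  case: eqP => [->|/eqP im']; first by rewrite addNr rmorph0.
  rewrite oppr0 add0r -inner_conj ?hA.1 // pp ?rmorph0 ?mulr0 ?rmorph0 //.
  by rewrite ltn_neqAle im' im.
split.
- move=> i j ij; rewrite leq_eqVlt => /orP[/eqP jE|]; last exact: zz.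
  by subst j; rewrite zzS.
- move=> i j ij; rewrite leq_eqVlt => /orP[/eqP jE|]; last exact: pp.
  by subst j; rewrite ppS.
- move=> j; rewrite leq_eqVlt => /orP[/eqP ->|]; last exact: pi0.
  exact: pi_gt0.
Qed.

(** Since [z (j+1)] is [p (j+1)] minus a multiple of [p j] and the directions
    are conjugate, [A] is tridiagonal on the [z j], with pivots
    [pi j / rho j]. *)
Lemma cg_sum_ln_le :
  \sum_(j < k) ln (1 + complex.Re (rho j.+1) / complex.Re (rho j))
  <= logdet_div A P.
Proof.
have [zz pp pi0] := cg_orthogonal _ (leqnn k).
have rhoE j : (j <= k)%N -> (complex.Re (rho j))%:C%C = rho j.
  by move=> jk; rewrite ReK // ltW // rho_gt0.
have piE j : (j <= k)%N -> (complex.Re (pi j))%:C%C = pi j.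
  by move=> jk; rewrite ReK // ltW // pi0.
have rho_neq0 j : (j <= k)%N -> rho j != 0.
  by move=> jk; rewrite gt_eqF // rho_gt0.
have zE j : (j < k)%N -> z j.+1 = p j.+1 + (- (rho j.+1 / rho j)) *: p j.
  by move=> jk; rewrite pS // scaleNr addrK.
apply: (logdet_div_tridiagonal (z := z)
          (rho := fun j => complex.Re (rho j))
          (d := fun j => complex.Re (pi j) / complex.Re (rho j)) hA hP).
- by move=> j jk; rewrite rhoE.
- by move=> j jk; apply: Re_gt0; apply: rho_gt0.
- exact: zz.
- rewrite -p0E -/(pi 0%N) !(rmorphM, fmorphV) /= !rhoE // piE //.
  by rewrite divfK ?rho_neq0.
- move=> j jk; have jk' := ltnW jk.
  have r1 := rho_neq0 _ jk'; have r2 := rho_neq0 _ jk.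
  rewrite !(rmorphN, rmorphD, rmorphM, fmorphV) /= !rhoE // !piE //.
  have zp : inner A (z j) (p j.+1) = 0 /\ inner A (z j) (p j) = pi j.
    case: j jk jk' r1 r2 => [|j] jk jk' r1 r2; first by rewrite -p0E pp.
    rewrite [z j.+1]zE // !innerDl !innerZl.
    by rewrite (pp j.+1 j.+2) // (pp j j.+2) // (pp j j.+1) // !mulr0 !addr0.
  split.
    rewrite zE // innerDl !innerDr !innerZl !innerZr.
    rewrite -[inner A (p j.+1) (p j)]inner_conj ?hA.1 // (pp j j.+1) // rmorph0.
    rewrite rmorphN /= beta_conj // -/(pi _) -/(pi _); field.
    by rewrite r1 r2.
  by rewrite [z j.+1]zE // innerDr innerZr zp.1 zp.2; field.
move=> i [//|j] ij jk; rewrite (zE j) //.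
have ik : (i < k)%N by apply: leq_trans jk; exact: ltnW.
rewrite innerDr innerZr.
have h l : (i < l)%N -> (l <= k)%N -> inner A (z i) (p l) = 0.
  move=> il lk; case: i il {ij ik} => [|i] il; first by rewrite -p0E pp.
  rewrite zE ?innerDl ?innerZl ?pp ?mulr0 ?addr0 //; first exact: ltnW.
  exact: leq_trans (ltnW il) lk.
by rewrite !h ?mulr0 ?addr0 // ltnW.
Qed.

End ConjugateGradient.

(** * The residual bound *)

Section PCG.
Local Open Scope sesquilinear_scope.
Context {R : realType} {n : nat}.
Local Notation C := R[i].
Variables (A P : 'M[C]_n) (b x0 : 'cV[C]_n).
Hypotheses (hA : hermitian_posdef A) (hP : hermitian_posdef P).
Let r j := pcg_residual A P b x0 j.
Let p j := direction (pcg A P b x0 j).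
Let z j := invmx P *m r j.

Lemma pcg_residual_stop j k : (j <= k)%N -> r j = 0 -> r k = 0.
Proof.
move=> /subnK <-; elim: (k - j)%N => // l IHl r0; have := IHl r0.
rewrite addSn /r /pcg_residual /pcg iterS; case: (iter _ _ _) => x r' p' /= ->.
by rewrite eqxx.
Qed.

Lemma pcg_residualS j : r j != 0 -> r j.+1 =
  r j - (inner (invmx P) (r j) (r j) / inner A (p j) (p j)) *: (A *m p j).
Proof.
rewrite /p /r /pcg_residual /pcg iterS; case: (iter _ _ _) => x r' p' /=.
by move=> /negPf ->.
Qed.

Lemma pcg_directionS j : r j != 0 -> p j.+1 = z j.+1 +
  (inner (invmx P) (r j.+1) (r j.+1) / inner (invmx P) (r j) (r j)) *: p j.
Proof.
rewrite /p /z /r /pcg_residual /pcg iterS; case: (iter _ _ _) => x r' p' /=.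
by move=> /negPf ->.
Qed.

Let uP : P \in unitmx.
Proof. by rewrite unitmxE unitfE gt_eqF ?posdef_det_gt0. Qed.

Lemma inner_invmx u v :
  inner (invmx P) u v = inner P (invmx P *m u) (invmx P *m v).
Proof.
rewrite -inner_congr; congr (inner _ u v).
rewrite -mulmxA mulmxV // mulmx1 trmx_inv map_invmx.
by rewrite (hermsymmxP _ hP.1).
Qed.

Lemma pcg_sum_ln_le k : r k != 0 ->
  let rho j := norm_wrt (invmx P) (r j) ^+ 2 in
  (forall j, (j <= k)%N -> 0 < rho j) /\
  \sum_(j < k) ln (1 + rho j.+1 / rho j) <= logdet_div A P.
Proof.
move=> rk rho.
have r_neq0 j : (j <= k)%N -> r j != 0.
  by move=> jk; apply: contra_neq rk; exact: pcg_residual_stop.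
have z_neq0 j : (j <= k)%N -> z j != 0.
  move=> /r_neq0; apply: contra_neq => zj0.
  by rewrite -[r j](mulKVmx uP) -/(z j) zj0 mulmx0.
have rhoE j : (j <= k)%N -> rho j = complex.Re (inner P (z j) (z j)).
  move=> jk; rewrite /rho /norm_wrt inner_invmx -/(z j) sqr_sqrtr //.
  by rewrite Re_ge0 // ltW // hP.2 // z_neq0.
split=> [j jk|]; first by rewrite rhoE // Re_gt0 // hP.2 // z_neq0.
have := @cg_sum_ln_le R n A P hA hP z p k z_neq0 erefl.
set S := \sum_(_ < _) _; suff <- : S = \sum_(j < k) ln (1 + rho j.+1 / rho j).
  apply=> j jk.
    rewrite [in LHS]/z pcg_residualS ?r_neq0 1?ltnW // mulmxBr -scalemxAr.
    by rewrite inner_invmx.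
  by rewrite pcg_directionS ?r_neq0 1?ltnW // !inner_invmx.
by apply: eq_bigr => j _; rewrite !rhoE // ltnW.
Qed.

End PCG.

Local Open Scope complex_scope.

Theorem corollary3 (R : realType) (n : nat) (A P : 'M[R[i]]_n)
    (hA : hermitian_posdef A) (hP : hermitian_posdef P)
    (b x0 : 'cV[R[i]]_n) (k : nat) (hk : (1 <= k)%N) :
  norm_wrt (invmx P) (pcg_residual A P b x0 k) <=
    (expR (logdet_div A P / k%:R) - 1) `^ (k%:R / 2)
    * norm_wrt (invmx P) (pcg_residual A P b x0 0).
Proof.
pose nu j := norm_wrt (invmx P) (pcg_residual A P b x0 j).
have nu_ge0 j : 0 <= nu j by exact: sqrtr_ge0.
have [rk0|rk] := eqVneq (pcg_residual A P b x0 k) 0.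
  rewrite rk0 [X in X <= _]/norm_wrt /inner mulmx0 mxE /= sqrtr0.
  by rewrite mulr_ge0 ?powR_ge0 ?sqrtr_ge0.
rewrite -/(nu 0%N) -/(nu k).
have [rho_gt0 sum_le] : (forall j, (j <= k)%N -> 0 < nu j ^+ 2) /\
    \sum_(j < k) ln (1 + nu j.+1 ^+ 2 / nu j ^+ 2) <= logdet_div A P.
  exact: pcg_sum_ln_le.
have nu_gt0 j : (j <= k)%N -> 0 < nu j.
  move=> /rho_gt0 nu2_gt0; rewrite lt_def nu_ge0 andbT.
  by move: nu2_gt0; apply: contraTneq => ->; rewrite expr0n ltxx.
have kR : 0 < k%:R :> R by rewrite ltr0n.
have ratio_gt0 j : (j < k)%N -> 0 < nu j.+1 ^+ 2 / nu j ^+ 2.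
  by move=> jk; rewrite divr_gt0 // rho_gt0 // ltnW.
have := le_trans (sum_ln1p_ge hk ratio_gt0) sum_le.
have -> : \sum_(j < k) ln (nu j.+1 ^+ 2 / nu j ^+ 2)
          = (ln (nu k) - ln (nu 0%N)) *+ 2.
  transitivity (\sum_(0 <= j < k) (ln (nu j.+1) *+ 2 - ln (nu j) *+ 2)).
    rewrite big_mkord; apply: eq_bigr => j _.
    have jk := ltn_ord j; have jk' := ltnW jk.
    by rewrite ln_div ?posrE ?rho_gt0 // !lnXn ?nu_gt0.
  by rewrite telescope_sumr // mulrnBl.
set g := expR _ => bound.
have g_le : g <= expR (logdet_div A P / k%:R) - 1.
  rewrite lerBrDl -[1 + g]lnK ?posrE ?addr_gt0 ?expR_gt0 // ler_expR.
  by rewrite ler_pdivlMr // mulrC.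
have -> : nu k = g `^ (k%:R / 2) * nu 0%N.
  rewrite /powR gt_eqF ?expR_gt0 // expRK.
  have -> : k%:R / 2 * ((ln (nu k) - ln (nu 0%N)) *+ 2 / k%:R)
            = ln (nu k) - ln (nu 0%N).
    by field; rewrite gt_eqF.
  by rewrite expRB !lnK ?posrE ?nu_gt0 // divfK // gt_eqF ?nu_gt0.
rewrite ler_wpM2r // ge0_ler_powR ?nnegrE ?divr_ge0 ?expR_ge0 //.
exact: le_trans (expR_ge0 _) g_le.
Qed.
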